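(* For each $n$, let $P$ be a symmetric $n\times n$ matrix with entries $P_{ij}\in[0,1]$, and assume $P_{ij}=\omega\bigl(\sqrt{\log n/n}\bigr)$ for all $i\neq j$. Let $G=(V,E)$ be a random graph generated from $P$, let $T^*$ be an optimal HC-tree for $G$ (minimizing $\rho_G$), and let $\bar T^*$ be an optimal HC-tree for the expectation graph $\bar G$. Then with high probability $$\rho^*_G=\rho_G(T^* )=(1+o(1))\,\frac{\mathrm{TC}_{\bar G}(\bar T^* )}{\mathbb{E}[\mathrm{BC}(G)]}.$$
   Context: A random graph generated from $P$ on $V=\{v_1,\dots,v_n\}$ contains each edge $(v_i,v_j)$ independently with probability $P_{ij}$, every present edge having weight $1$ (non-edges weight $0$). The expectation graph $\bar G$ is the complete weighted graph on $V$ with $w_{ij}=P_{ij}$. ''With high probability'' means with probability larger than $1-n^{-\varepsilon}$ for some constant $\varepsilon>0$; asymptotics are as $n\to\infty$. An HC-tree for $V$ is a rooted tree with leaf set $V$. For distinct $i,j,k$: $\{i,j|k\}$ holds in $T$ if $\mathrm{LCA}(v_i,v_j)$ is a proper descendant of $\mathrm{LCA}(v_i,v_j,v_k)$; $\{i|j|k\}$ holds if $\mathrm{LCA}(v_i,v_j)=\mathrm{LCA}(v_j,v_k)=\mathrm{LCA}(v_i,v_j,v_k)$. Triplet cost $c_T(i,j,k)$: $w_{ik}+w_{jk}$ if $\{i,j|k\}$; $w_{ij}+w_{jk}$ if $\{i,k|j\}$; $w_{ij}+w_{ik}$ if $\{j,k|i\}$; $w_{ij}+w_{jk}+w_{ik}$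 if $\{i|j|k\}$. $\mathrm{TC}_G(T)=\sum c_T(i,j,k)$ and $\mathrm{BC}(G)=\sum\min\{w_{ij}+w_{ik},w_{ij}+w_{jk},w_{ik}+w_{jk}\}$ over unordered triples of distinct indices; $\rho_G(T)=\mathrm{TC}_G(T)/\mathrm{BC}(G)$ (with $0/0=1$, $x/0=+\infty$ for $x>0$), $\rho^*_G=\min_T\rho_G(T)$. *)

(* Defs.v *)
From HB Require Import structures.
From mathcomp Require Import all_boot all_order all_algebra.
From mathcomp Require Import all_classical all_reals all_analysis.
Set Implicit Arguments. Unset Strict Implicit. Unset Printing Implicit Defensive.
Import Order.TTheory GRing.Theory Num.Theory.
Local Open Scope ring_scope.

Inductive hctree (n : nat) : Type :=
| Leaf of 'I_n
| Node of seq (hctree n).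

Section Trees.
Variable n : nat.

Fixpoint leaves (t : hctree n) : seq 'I_n :=
  match t with
  | Leaf i => [:: i]
  | Node ts => flatten (map leaves ts)
  end.

(* all subtrees (= all nodes, each node viewed as the subtree rooted at it) *)
Fixpoint subtrees (t : hctree n) : seq (hctree n) :=
  t :: match t with
       | Leaf _ => [::]
       | Node ts => flatten (map subtrees ts)
       end.

(* every internal node has at least one child, so the leaves of the tree are
   exactly the Leaf nodes *)
Fixpoint wf_tree (t : hctree n) : bool :=
  match t with
  | Leaf _ => true
  | Node ts => (0 < size ts)%N && all wf_tree ts
  end.

Definition is_HC_tree (T : hctree n) : bool :=
  wf_tree T && perm_eq (leaves T) (enum 'I_n).

(* {i,j|k}: LCA(i,j) is a proper descendant of LCA(i,j,k), i.e. some node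
   has both i and j among its leaf-descendants but not k. *)
Definition sep3 (T : hctree n) (i j k : 'I_n) : bool :=
  has (fun s => [&& i \in leaves s, j \in leaves s & k \notin leaves s])
      (subtrees T).

Variable R : realType.

(* triplet cost c_T(i,j,k) for a weight function w; the last case is {i|j|k} *)
Definition triplet_cost (w : 'I_n -> 'I_n -> R) (T : hctree n) (i j k : 'I_n) : R :=
  if sep3 T i j k then w i k + w j k
  else if sep3 T i k j then w i j + w j k
  else if sep3 T j k i then w i j + w i k
  else w i j + w j k + w i k.

Definition TC (w : 'I_n -> 'I_n -> R) (T : hctree n) : R :=
  \sum_(i < n) \sum_(j < n | (i < j)%N) \sum_(k < n | (j < k)%N)
     triplet_cost w T i j k.

Definition BC (w : 'I_n -> 'I_n -> R) : R :=
  \sum_(i < n) \sum_(j < n | (i < j)%N) \sum_(k < n | (j < k)%N)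
     Num.min (w i j + w i k) (Num.min (w i j + w j k) (w i k + w j k)).

Definition rho (w : 'I_n -> 'I_n -> R) (T : hctree n) : \bar R :=
  if BC w == 0 then (if TC w T == 0 then 1%E else +oo%E)
  else (TC w T / BC w)%:E.

Definition optimal_tree (w : 'I_n -> 'I_n -> R) (T : hctree n) : Prop :=
  is_HC_tree T /\ forall T' : hctree n, is_HC_tree T' -> (rho w T <= rho w T')%E.

(* A graph is given by its edge set E : {set 'I_n * 'I_n}, each edge {v_i,v_j}
   (i <> j) being stored once as the ordered pair (i,j) with i < j. *)
Definition upper_pairs : {set 'I_n * 'I_n} := [set p : 'I_n * 'I_n | (p.1 < p.2)%N].

Definition graph_prob (P : 'M[R]_n) (E : {set 'I_n * 'I_n}) : R :=
  if E \subset upper_pairs then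
    \prod_(p in upper_pairs) (if p \in E then P p.1 p.2 else 1 - P p.1 p.2)
  else 0.

Definition graph_w (E : {set 'I_n * 'I_n}) (i j : 'I_n) : R :=
  if ((i, j) \in E) || ((j, i) \in E) then 1 else 0.

Definition expect_w (P : 'M[R]_n) (i j : 'I_n) : R := P i j.

Definition Prob (P : 'M[R]_n) (ev : {set 'I_n * 'I_n} -> Prop) : R :=
  \sum_(E : {set 'I_n * 'I_n}) (if `[< ev E >] then graph_prob P E else 0).

Definition Expect (P : 'M[R]_n) (X : {set 'I_n * 'I_n} -> R) : R :=
  \sum_(E : {set 'I_n * 'I_n}) graph_prob P E * X E.

End Trees.

Arguments graph_w {n R} E i j.
Arguments upper_pairs {n}.

(* Main.v *)
Require Import Defs.
From HB Require Import structures.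
From mathcomp Require Import all_boot all_order all_algebra.
From mathcomp Require Import all_classical all_reals all_analysis.
From mathcomp Require Import ring lra zify.
Set Implicit Arguments. Unset Strict Implicit. Unset Printing Implicit Defensive.
Import Order.TTheory GRing.Theory Num.Theory.
Local Open Scope ring_scope.

(** McDiarmid's inequality for independent edges controls both costs.

    For a fixed vertex [k], the relation [sep3 T i j k] in [i, j] is an
    equivalence on the vertices other than [k], hence the kernel of a map
    ['I_n -> 'I_n].  So the triplet cost of every tree is a signed sum of [2n]
    block sums (total weight of the pairs identified by such a map), and a union
    bound over the [n ^ n] maps replaces one over trees.  With
    [q = K sqrt (ln n / n)] a lower bound on the probabilities, a deviation of
    order [q n^2] of one block sum has probability [exp (- c K^2 n ln n)], while
    every triplet cost is of order at least [q n^3].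

    Flipping an edge changes [BC] by at most [n], and [E[BC]] is of order at
    least [q^2 n^3], so a relative deviation of [BC] has probability
    [exp (- c K^4 (ln n)^2)].  Since [K] is arbitrary, the relative error can be
    sent to [0] along a diagonal sequence. *)

(** * Bounded differences for product Bernoulli measures *)

Section BernoulliProduct.
Variables (R : realType) (I : finType) (p : I -> R).
Hypothesis p01 : forall i, 0 <= p i <= 1.
Implicit Types (F G : {set I} -> R) (E : {set I}) (i : I).

Definition bern E : R := \prod_i (if i \in E then p i else 1 - p i).
Definition Ex F : R := \sum_(E : {set I}) bern E * F E.
(** Conditional expectation of [F] given all coordinates other than [i]; its value no longer depends
    on whether [i] lies in [E]. *)
Definition avg i F E : R := p i * F (i |: E) + (1 - p i) * F (E :\ i).

Lemma bern_ge0 E : 0 <= bern E.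
Proof.
apply: prodr_ge0 => i _; have /andP[p0 p1] := p01 i.
by case: ifP => // _; rewrite subr_ge0.
Qed.

(** Sets of mass zero may be ignored. For the graph measure this allows assuming that every pair in
    [E] is increasing. *)
Lemma Ex_le F G : (forall E, bern E != 0 -> F E <= G E) -> Ex F <= Ex G.
Proof.
move=> FG; apply: ler_sum => E _; have [->|nz] := eqVneq (bern E) 0.
  by rewrite !mul0r.
by apply: ler_wpM2l; [exact: bern_ge0|exact: FG].
Qed.

Lemma eq_Ex F G : (forall E, bern E != 0 -> F E = G E) -> Ex F = Ex G.
Proof.
move=> FG; apply: eq_bigr => E _; have [->|/FG->//] := eqVneq (bern E) 0.
by rewrite !mul0r.
Qed.

Lemma ExZ (a : R) F : Ex (fun E => a * F E) = a * Ex F.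
Proof. by rewrite /Ex mulr_sumr; apply: eq_bigr => E _; rewrite mulrCA. Qed.

Lemma ExD F G : Ex (fun E => F E + G E) = Ex F + Ex G.
Proof. by rewrite /Ex -big_split; apply: eq_bigr => E _; rewrite mulrDr. Qed.

Lemma Ex_sum (J : finType) (Q : pred J) (F : J -> {set I} -> R) :
  Ex (fun E => \sum_(j | Q j) F j E) = \sum_(j | Q j) Ex (F j).
Proof.
by rewrite /Ex exchange_big; apply: eq_bigr => E _; rewrite mulr_sumr.
Qed.

Lemma Ex_cst (a : R) : Ex (fun=> a) = a.
Proof.
rewrite /Ex -mulr_suml -[RHS]mul1r; congr (_ * _); rewrite /bern -bigA_distr.
by rewrite big1// => i _ /=; lra.
Qed.

Lemma sum_set_split i F :
  \sum_(E : {set I}) F E = \sum_(E : {set I} | i \notin E) (F (i |: E) + F E).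
Proof.
rewrite (bigID (fun E : {set I} => i \in E)) /= big_split /=; congr (_ + _).
rewrite (reindex_onto (fun E => i |: E) (fun E => E :\ i)) /=; last first.
  by move=> E; exact: finset.setD1K.
apply: eq_bigl => E; rewrite !inE eqxx /=; apply/eqP/idP => [<-|iE].
  by rewrite !inE eqxx.
exact: finset.setU1K.
Qed.

Lemma Ex_avg i F : Ex (avg i F) = Ex F.
Proof.
rewrite /Ex !(sum_set_split i); apply: eq_bigr => E iE.
(* [nu] is the mass of the remaining coordinates, common to [E] and [i |: E]; after factoring it
   out, only [p i + (1 - p i) = 1] is left to use. *)
pose nu := \prod_(j | j != i) (if j \in E then p j else 1 - p j).
have -> : bern (i |: E) = p i * nu.
  rewrite /bern (bigD1 i)//= finset.setU11; congr (_ * _).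
  by apply: eq_bigr => j /negPf ji; rewrite !inE ji.
have -> : bern E = (1 - p i) * nu by rewrite /bern (bigD1 i)//= (negPf iE).
rewrite /avg finset.setUA finset.setUid finset.setU1K//.
have -> : E :\ i = E by apply/finset.setDidPl; rewrite disjoint_sym disjoints1.
ring.
Qed.

Section McDiarmid.
Variable c : R.

Definition bdiff F := forall i E, `|F (i |: E) - F (E :\ i)| <= c.

(** In direction [i] the average is constant. In any other direction its difference is a convex
    combination of two differences of [F]. *)
Lemma bdiff_avg i F : 0 <= c -> bdiff F -> bdiff (avg i F).
Proof.
move=> c0 Fc j E; rewrite /avg; have [->|ji] := eqVneq j i.
  have -> : i |: (i |: E) = i |: (E :\ i).
    by apply/setP => x; rewrite !inE; case: eqVneq.
  have -> : (i |: E) :\ i = E :\ i :\ i.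
    by apply/setP => x; rewrite !inE; case: eqVneq.
  by rewrite subrr normr0.
have -> : i |: (j |: E) = j |: (i |: E) by rewrite finset.setUCA.
have -> : i |: (E :\ j) = (i |: E) :\ j.
  by apply/setP => x; rewrite !inE; case: (eqVneq x i) => // ->; rewrite eq_sym ji.
have -> : (j |: E) :\ i = j |: (E :\ i).
  by apply/setP => x; rewrite !inE; case: (eqVneq x j) => // ->; rewrite ji.
have -> : E :\ j :\ i = E :\ i :\ j by rewrite finset.setDDl finset.setUC -finset.setDDl.
have /andP[p0 p1] := p01 i.
have := Fc j (i |: E); have := Fc j (E :\ i); rewrite !ler_norml.
move: (F _) (F _) (F _) (F _) => a b a' b' /andP[h1 h2] /andP[h3 h4].
by apply/andP; split; nra.
Qed.

Lemma bdiff_foldr s F : 0 <= c -> bdiff F -> bdiff (foldr avg F s).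
Proof. by move=> c0 Fc; elim: s => //= i s IHs; exact: bdiff_avg. Qed.

Lemma avg_setU1 i j F :
  (forall E, F (j |: E) = F E) -> forall E, avg i F (j |: E) = avg i F E.
Proof.
move=> Fj E; rewrite /avg finset.setUCA Fj; congr (_ + _ * _).
have [<-|ji] := eqVneq j i.
  by congr F; apply/setP => x; rewrite !inE; case: eqVneq.
rewrite -[RHS]Fj; congr F; apply/setP => x; rewrite !inE.
by case: (eqVneq x j) => // ->; rewrite ji.
Qed.

Lemma foldr_avg_setU1 s F j E : j \in s ->
  foldr avg F s (j |: E) = foldr avg F s E.
Proof.
move=> js; elim: s js E => //= i s IHs; rewrite inE => /predU1P[->|js] E.
  rewrite /avg finset.setUA finset.setUid; congr (_ + _ * _); congr (foldr _ _ _ _).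
  by apply/setP => x; rewrite !inE; case: eqVneq.
by apply: avg_setU1 => E'; exact: IHs.
Qed.

(** Once every coordinate has been averaged the function is constant, and no averaging step changes
    the expectation. *)
Lemma foldr_avg_enum F E : foldr avg F (enum I) E = Ex F.
Proof.
set G := foldr _ _ _.
have Gcst E' : G E' = G finset.set0.
  have [m] := ubnP #|E'|; elim: m E' => // m IHm E' Em.
  have [->//|[j jE]] := finset.set_0Vmem E'.
  rewrite -(finset.setD1K jE) /G foldr_avg_setU1 ?mem_enum//; apply: IHm.
  by move: Em; rewrite (cardsD1 j) jE.
have -> : G E = Ex G.
  by rewrite -(Ex_cst (G E)); apply: eq_Ex => E' _; rewrite Gcst [RHS]Gcst.
by rewrite /G; elim: (enum I) => //= i s <-; exact: Ex_avg.
Qed.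

(** From [1 - x <= expR (- x)] one gets [(1 - x) * expR x <= 1], while the quadratic multiplied by
    [1 - x] is at least 1 in this range. *)
Lemma expR_le_quad (x : R) : x <= 2^-1 -> expR x <= 1 + x + 2 * x ^+ 2.
Proof.
move=> x2; have := expR_ge1Dx (- x); rewrite expRN => h.
have e0 := expR_gt0 x.
have h1 : (1 - x) * expR x <= 1 by rewrite -ler_pdivlMr// div1r.
have h2 : 0 < 1 - x by lra.
rewrite -(ler_pM2l h2); apply: (le_trans h1).
have -> : (1 - x) * (1 + x + 2 * x ^+ 2) = 1 + x ^+ 2 * (1 - 2 * x) by ring.
by rewrite lerDl mulr_ge0 ?sqr_ge0//; lra.
Qed.

(** Conditional Hoeffding-type bound. Around the mean [m] the two exponents deviate by
    [(1 - p i) * x] and [- p i * x]; in the average of the quadratic bounds the linear terms cancel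
    and the squares have total weight [p i * (1 - p i) <= 1]. *)
Lemma avg_expR i F (l : R) E : 0 <= c -> bdiff F -> `|l| * c <= 2^-1 ->
  avg i (fun E => expR (l * F E)) E
  <= expR (l * avg i F E + 2 * (l * c) ^+ 2).
Proof.
move=> c0 Fc lc; rewrite /avg; have /andP[p0 p1] := p01 i.
have := Fc i E; move: (F (i |: E)) (F (E :\ i)) => a b abc.
set m := p i * a + (1 - p i) * b.
pose x := l * (a - b).
have xlc : `|x| <= `|l| * c by rewrite /x normrM ler_wpM2l.
have x2 : x ^+ 2 <= (l * c) ^+ 2.
  by rewrite -[leLHS]real_normK ?num_real// -[leRHS]real_normK ?num_real// lerXn2r ?nnegrE// [leRHS] normrM (ger0_norm c0).
have := xlc; rewrite ler_norml => /andP[x3 x4].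
have q1 : expR ((1 - p i) * x) <= 1 + (1 - p i) * x + 2 * ((1 - p i) * x) ^+ 2.
  by apply: expR_le_quad; nra.
have q2 : expR (- p i * x) <= 1 + (- p i * x) + 2 * (- p i * x) ^+ 2.
  by apply: expR_le_quad; nra.
have -> : l * a = l * m + (1 - p i) * x by rewrite /m /x; ring.
have -> : l * b = l * m + (- p i * x) by rewrite /m /x; ring.
rewrite !expRD mulrCA [X in _ + X]mulrCA -mulrDr ler_wpM2l ?expR_ge0//.
apply: le_trans (expR_ge1Dx _).
have := sqr_ge0 x; clearbody x.
move: q1 q2 x2; rewrite [((1 - p i) * x) ^+ 2]exprMn [(- p i * x) ^+ 2]exprMn sqrrN.
move: (expR ((1 - p i) * x)) (expR (- p i * x)) (x ^+ 2) ((l * c) ^+ 2).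
move=> u v X Y q1 q2 XY X0.
have h1 := ler_wpM2l p0 q1.
have p1' : 0 <= 1 - p i by lra.
have h2 := ler_wpM2l p1' q2.
have h3 : p i * u + (1 - p i) * v <= 1 + 2 * (p i * (1 - p i) * X) by lra.
apply: (le_trans h3).
have : p i * (1 - p i) <= 1 by nra.
have : 0 <= p i * (1 - p i) by exact: mulr_ge0.
by move: (p i * (1 - p i)) => z z0 z1; nra.
Qed.

(* Integrating out one coordinate at a time, each at the price of a factor
   [expR (2 * (l * c) ^+ 2)], plays the role of the Doob martingale. *)
Lemma Ex_expR_foldr s F (l : R) : 0 <= c -> bdiff F -> `|l| * c <= 2^-1 ->
  Ex (fun E => expR (l * F E)) <=
  expR (2 * (l * c) ^+ 2 * (size s)%:R) *
    Ex (fun E => expR (l * foldr avg F s E)).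
Proof.
move=> c0 Fc lc; elim: s => [|i s IHs]; first by rewrite mulr0 expR0 mul1r.
apply: (le_trans IHs); rewrite /= -(natr1 (size s)) mulrDr mulr1 expRD -[leRHS]mulrA.
rewrite ler_wpM2l ?expR_ge0// -ExZ -(Ex_avg i); apply: Ex_le => E _.
rewrite -expRD addrC; apply: avg_expR => //; exact: bdiff_foldr.
Qed.

Lemma mcdiarmid_mgf F (l : R) : 0 <= c -> bdiff F -> `|l| * c <= 2^-1 ->
  Ex (fun E => expR (l * (F E - Ex F))) <= expR (2 * (l * c) ^+ 2 * #|I|%:R).
Proof.
move=> c0 Fc lc; have := Ex_expR_foldr (enum I) c0 Fc lc.
under [X in _ * X]eq_Ex do rewrite foldr_avg_enum.
rewrite Ex_cst -cardE; set K := expR (2 * _ * _) => h.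
under eq_Ex do rewrite mulrBr expRD mulrC expRN.
rewrite ExZ -(ler_pM2l (expR_gt0 (l * Ex F))) mulrA divff ?mul1r ?expR_eq0//.
  by rewrite mulrC.
Qed.

End McDiarmid.
End BernoulliProduct.

(** * Separation in trees and sums over triples *)

Section TreeStructure.
Variable n : nat.
Implicit Types (T : hctree n) (i j k : 'I_n).

(* The generated principle gives no hypothesis on the children of a [Node]. *)
Lemma hctree_ind_all (Q : hctree n -> Prop) :
  (forall i, Q (Leaf i)) ->
  (forall ts, foldr (fun t r => Q t /\ r) True ts -> Q (Node ts)) ->
  forall T, Q T.
Proof.
move=> QL QN; fix IH 1 => -[i|ts]; first exact: QL.
by apply: QN; elim: ts => //= t ts IHts; split.
Qed.

Definition clusters T : seq (seq 'I_n) := map (@leaves n) (subtrees T).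

Lemma clusters_Node ts :
  clusters (Node ts) = leaves (Node ts) :: flatten (map clusters ts).
Proof. by rewrite /clusters /= map_flatten -map_comp. Qed.

Lemma sub_clusters T l : l \in clusters T -> {subset l <= leaves T}.
Proof.
elim/hctree_ind_all: T l => [i|ts IH] l; first by rewrite inE => /eqP ->.
rewrite clusters_Node inE => /predU1P[->//|].
rewrite [leaves _]/=; elim: ts IH => //= t ts IHts [IHt /IHts{}IHts].
rewrite mem_cat => /orP[/IHt lt|/IHts lts] x xl; rewrite mem_cat.
  by rewrite lt.
by rewrite lts ?orbT.
Qed.

Lemma sub_flatten_clusters ts l : l \in flatten (map clusters ts) ->
  {subset l <= flatten (map (@leaves n) ts)}.
Proof.
by move=> lts; apply: (@sub_clusters (Node ts)); rewrite clusters_Node inE lts orbT.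
Qed.

(** As no leaf repeats, distinct children of a node have disjoint leaves. Two clusters sharing [x]
    thus lie below the same child, where induction applies, unless one of them is the whole node. *)
Lemma clusters_laminar T l1 l2 x : uniq (leaves T) ->
  l1 \in clusters T -> l2 \in clusters T -> x \in l1 -> x \in l2 ->
  {subset l1 <= l2} \/ {subset l2 <= l1}.
Proof.
elim/hctree_ind_all: T => [i|ts IH].
  by rewrite !inE => _ /eqP-> /eqP->; left.
move=> uT; rewrite clusters_Node !inE.
move=> /predU1P[->|h1]; first by move=> /predU1P[->|/sub_flatten_clusters]; [left|right].
move=> /predU1P[->|h2]; first by move/sub_flatten_clusters: h1; left.
move: uT h1 h2; rewrite [leaves _]/=.
elim: ts IH => //= t ts IHts [IHt /IHts{}IHts].
rewrite cat_uniq => /and3P[ut /hasPn disj uts].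
rewrite !mem_cat => /orP[h1|h1] /orP[h2|h2] x1 x2.
- exact: IHt.
- by have := disj _ (sub_flatten_clusters h2 x2); rewrite (sub_clusters h1 x1).
- by have := disj _ (sub_flatten_clusters h1 x1); rewrite (sub_clusters h2 x2).
- exact: IHts.
Qed.

Lemma leaf_cluster T i : i \in leaves T -> [:: i] \in clusters T.
Proof.
elim/hctree_ind_all: T => [j|ts IH]; first by rewrite inE => /eqP->; exact: mem_head.
rewrite clusters_Node inE => iT; apply/orP; right; move: iT; rewrite [leaves _]/=.
elim: ts IH => //= t ts IHts [IHt /IHts{}IHts].
by rewrite !mem_cat => /orP[/IHt->//|/IHts->]; rewrite orbT.
Qed.

Lemma sep3P T i j k :
  reflect (exists2 l, l \in clusters T & [&& i \in l, j \in l & k \notin l])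
          (sep3 T i j k).
Proof.
rewrite /sep3 -(has_map (@leaves n) (fun l => [&& i \in l, j \in l & k \notin l])).
exact: hasP.
Qed.

Lemma sep3C T i j k : sep3 T i j k = sep3 T j i k.
Proof. by rewrite /sep3; apply: eq_has => s; rewrite andbCA. Qed.

Lemma sep3_refl T i k : i \in leaves T -> i != k -> sep3 T i i k.
Proof.
move=> iT ik; apply/sep3P; exists [:: i]; first exact: leaf_cluster.
by rewrite !inE eqxx eq_sym ik.
Qed.

Lemma sep3_right T i k : sep3 T i k k = false.
Proof. by apply/negP => /sep3P[l _ /and3P[_ ->]]. Qed.

Section Uniq.
Variable T : hctree n.
Hypothesis uT : uniq (leaves T).

(** The two witnessing clusters share [j], so one contains the other, and the larger one still
    avoids [k]. *)
Lemma sep3_trans i j l k : sep3 T i j k -> sep3 T j l k -> sep3 T i l k.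
Proof.
move=> /sep3P[s hs /and3P[i1 j1 k1]] /sep3P[t ht /and3P[j2 l2 k2]].
apply/sep3P; case: (clusters_laminar uT hs ht j1 j2) => sub.
  by exists t; rewrite // sub// l2.
by exists s; rewrite // i1 sub.
Qed.

Lemma sep3_exclusive i j k : sep3 T i j k -> sep3 T i k j = false.
Proof.
move=> /sep3P[s hs /and3P[i1 j1 k1]].
apply/negP => /sep3P[t ht /and3P[i2 k2 j2]].
case: (clusters_laminar uT hs ht i1 i2) => sub.
  by rewrite sub in j2.
by rewrite sub in k1.
Qed.

End Uniq.

(** Sends a vertex to a canonical representative of its class for separation from [k]. The vertex
    [k] is its own class, since a representative of any other vertex differs from [k]. *)
Definition sep_class T k : {ffun 'I_n -> 'I_n} :=
  [ffun i => if i == k then k else odflt k [pick j | sep3 T i j k]].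

Lemma sep_classP T k i j : is_HC_tree T -> i != j ->
  (sep_class T k i == sep_class T k j) = sep3 T i j k.
Proof.
move=> /andP[_ pT] ij; rewrite !ffunE.
have uT : uniq (leaves T) by rewrite (perm_uniq pT) enum_uniq.
have mT a : a \in leaves T by rewrite (perm_mem pT) mem_enum.
have pickP' a : a != k -> exists2 b, [pick b | sep3 T a b k] = Some b & sep3 T a b k.
  move=> ak; case: pickP => [b hb|h]; first by exists b.
  by have := h a; rewrite sep3_refl.
have nk a b : sep3 T a b k -> b != k.
  by apply: contraTN => /eqP->; rewrite sep3_right.
have [ik|ik] := eqVneq i k; have [jk|jk] := eqVneq j k.
- by rewrite ik jk eqxx in ij.
- have [b -> hb] := pickP' _ jk; rewrite /= ik sep3C sep3_right.
  by rewrite eq_sym; apply/negbTE/nk/hb.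
- have [b -> hb] := pickP' _ ik; rewrite /= jk sep3_right.
  exact/negbTE/nk/hb.
apply/eqP/idP => [|sij].
  have [b -> hb] := pickP' _ ik; have [b' -> hb'] := pickP' _ jk.
  by move=> /= bb; move: hb'; rewrite -bb sep3C; exact: sep3_trans.
congr odflt; apply: eq_pick => b; apply/idP/idP; last exact: sep3_trans.
by apply: sep3_trans => //; rewrite sep3C.
Qed.

End TreeStructure.

Section TripleSums.
Variables (n : nat) (R : realType).
Implicit Types (w u : 'I_n -> 'I_n -> R) (T : hctree n).

Local Notation sum3 F :=
  (\sum_(i < n) \sum_(j < n | (i < j)%N) \sum_(k < n | (j < k)%N) F i j k).

(** Each of the three terms singles out one vertex of the triple as the last argument; summing over
    that vertex first leaves the pairs that avoid it. *)
Lemma sum3_reindex (h : 'I_n -> 'I_n -> 'I_n -> R) :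
  sum3 (fun i j k => h i j k + h i k j + h j k i) =
  \sum_(k < n) \sum_(i < n) \sum_(j < n | (i < j)%N && ((i != k) && (j != k))) h i j k.
Proof.
(* Moving the order conditions into the summand makes all ranges independent, so that the sums can
   be exchanged freely. *)
pose pw (b : bool) (x : R) := if b then x else 0.
transitivity (\sum_(i < n) \sum_(j < n) \sum_(k < n)
   (pw ((i < j) && (j < k))%N (h i j k) + pw ((i < k) && (k < j))%N (h i j k)
    + pw ((k < i) && (i < j))%N (h i j k))).
  transitivity (sum3 h + sum3 (fun i j k => h i k j) + sum3 (fun i j k => h j k i)).
    rewrite -!big_split; apply: eq_bigr => i _ /=.
    rewrite -!big_split; apply: eq_bigr => j _ /=.
    by rewrite -!big_split.
  have e3 (h' : 'I_n -> 'I_n -> 'I_n -> R) : sum3 h' =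
      \sum_(i < n) \sum_(j < n) \sum_(k < n) pw ((i < j) && (j < k))%N (h' i j k).
    apply: eq_bigr => i _; rewrite big_mkcond; apply: eq_bigr => j _.
    case: ifP => _; last by rewrite big1.
    by rewrite big_mkcond.
  rewrite !e3.
  have -> : \sum_(i < n) \sum_(j < n) \sum_(k < n) pw ((i < j) && (j < k))%N (h i k j)
     = \sum_(i < n) \sum_(j < n) \sum_(k < n) pw ((i < k) && (k < j))%N (h i j k).
    by apply: eq_bigr => i _; exact: exchange_big.
  have -> : \sum_(i < n) \sum_(j < n) \sum_(k < n) pw ((i < j) && (j < k))%N (h j k i)
     = \sum_(i < n) \sum_(j < n) \sum_(k < n) pw ((k < i) && (i < j))%N (h i j k).
    by rewrite exchange_big; apply: eq_bigr => i _; exact: exchange_big.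
  rewrite -!big_split; apply: eq_bigr => i _ /=.
  rewrite -!big_split; apply: eq_bigr => j _ /=.
  by rewrite -!big_split.
rewrite [RHS]exchange_big; apply: eq_bigr => i _.
transitivity (\sum_(k < n) \sum_(j < n) pw ((i < j)%N && ((i != k) && (j != k))) (h i j k)).
  rewrite exchange_big; apply: eq_bigr => k _; apply: eq_bigr => j _ /=.
  rewrite -!(inj_eq val_inj) /= /pw.
  by case: (ltngtP i j); case: (ltngtP j k); case: (ltngtP i k) => //=;
     rewrite ?add0r ?addr0//; lia.
by apply: eq_bigr => k _; rewrite [RHS]big_mkcond.
Qed.

(** With the largest index outermost, the hockey-stick identity evaluates the inner sums one after
    the other. *)
Lemma sum3_const (a : R) : sum3 (fun _ _ _ => a) = a *+ 'C(n, 3).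
Proof.
transitivity (\sum_(k < n) \sum_(j < n | (j < k)%N) \sum_(i < n | (i < j)%N) a).
  transitivity (\sum_(i < n) \sum_(k < n) \sum_(j < n | (i < j)%N && (j < k)%N) a).
    apply: eq_bigr => i _; rewrite (exchange_big_dep xpredT)//=.
  rewrite exchange_big; apply: eq_bigr => k _ /=.
  rewrite (exchange_big_dep (fun j : 'I_n => (j < k)%N))//=; last by move=> i j _ /andP[].
  by apply: eq_bigr => j jk; apply: eq_bigl => i; rewrite jk andbT.
have e1 (j : 'I_n) : \sum_(i < n | (i < j)%N) a = a *+ 'C(j, 1).
  by rewrite -(@big_ord_widen _ _ _ j n (fun=> a) (ltnW (ltn_ord j))) sumr_const card_ord bin1.
have sumC m (b : nat) : (\sum_(k < m) a *+ 'C(k, b) = a *+ 'C(m, b.+1)).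
  elim: m => [|m IH]; first by rewrite big_ord0 bin0n.
  by rewrite big_ord_recr /= IH -mulrnDr binS.
transitivity (\sum_(k < n) a *+ 'C(k, 2)); last exact: sumC.
apply: eq_bigr => k _; rewrite (eq_bigr _ (fun j _ => e1 j)).
by rewrite -(@big_ord_widen _ _ _ k n (fun j => a *+ 'C(j, 1)) (ltnW (ltn_ord k))) sumC.
Qed.

End TripleSums.

(** * Two-sided tail bound, block sums and Lipschitz estimates for the costs *)

Lemma mcdiarmid (R : realType) (I : finType) (p : I -> R) (c t S : R)
    (F : {set I} -> R) :
  (forall i, 0 <= p i <= 1) -> 0 <= c -> bdiff c F ->
  0 < S -> c ^+ 2 * #|I|%:R <= S -> 0 <= t -> t * c <= 2 * S ->
  Ex p (fun E => (t < `|F E - Ex p F|)%R%:R) <= 2 * expR (- (t ^+ 2 / (8 * S))).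
Proof.
(* This [l] minimises the Chernoff exponent [- (l * t) + 2 * l ^+ 2 * S], with minimum
   [- (t ^+ 2 / (8 * S))]; the hypothesis on [t * c] gives [l * c <= 2^-1]. *)
move=> p01 c0 Fc S0 cS t0 tc; pose l := t / (4 * S).
have l0 : 0 <= l by rewrite divr_ge0//; lra.
have tE : t = 4 * S * l by rewrite /l mulrC divfK//; lra.
clearbody l; have lc : l * c <= 2^-1.
  by rewrite -(ler_pM2l S0); move: tc; rewrite tE; lra.
have lc1 : `|l| * c <= 2^-1 by rewrite ger0_norm.
have lc2 : `|- l| * c <= 2^-1 by rewrite normrN.
have := lerD (mcdiarmid_mgf p01 c0 Fc lc1) (mcdiarmid_mgf p01 c0 Fc lc2).
rewrite -ExD mulNr sqrrN => H.
(* Markov's inequality for both tails at once: where [t < |x|], one of [expR (l * x)] and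
   [expR (- l * x)] is at least [expR (l * t)]. *)
apply: (@le_trans _ _ (expR (- (l * t)) *
   Ex p (fun E => expR (l * (F E - Ex p F)) + expR (- l * (F E - Ex p F))))).
  rewrite -ExZ; apply: Ex_le => // E _; move: (F E - Ex p F) => x.
  rewrite mulrDr -!expRD; case: ltP => [|_]; last by rewrite addr_ge0 ?expR_ge0.
  case: (ler0P x) => x0 tx.
    apply: (@le_trans _ _ (expR (- (l * t) + - l * x))); last by rewrite lerDr expR_ge0.
    by rewrite -[leLHS]expR0 ler_expR; nra.
  apply: (@le_trans _ _ (expR (- (l * t) + l * x))); last by rewrite lerDl expR_ge0.
  by rewrite -[leLHS]expR0 ler_expR; nra.
apply: (le_trans (ler_wpM2l (expR_ge0 _) H)).
have -> : 2 * expR (- (t ^+ 2 / (8 * S))) =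
    expR (- (t ^+ 2 / (8 * S))) + expR (- (t ^+ 2 / (8 * S))) by ring.
suff h : expR (- (l * t)) * expR (2 * (l * c) ^+ 2 * #|I|%:R) <=
    expR (- (t ^+ 2 / (8 * S))) by rewrite mulrDr lerD.
rewrite -expRD ler_expR.
have -> : t ^+ 2 / (8 * S) = 2 * l ^+ 2 * S.
  by rewrite tE; field; lra.
have : 2 * (l * c) ^+ 2 * #|I|%:R <= 2 * l ^+ 2 * S.
  have -> : 2 * (l * c) ^+ 2 * #|I|%:R = 2 * l ^+ 2 * (c ^+ 2 * #|I|%:R) by ring.
  by rewrite ler_wpM2l// mulr_ge0 ?sqr_ge0.
have -> : l * t = 4 * l ^+ 2 * S by rewrite [in LHS]tE; ring.
by move: (2 * (l * c) ^+ 2 * #|I|%:R) => A; lra.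
Qed.

Section Deviation.
Variables (n : nat) (R : realType).
Implicit Types (w u : 'I_n -> 'I_n -> R) (T : hctree n) (f : {ffun 'I_n -> 'I_n}).

Local Notation sum3 F :=
  (\sum_(i < n) \sum_(j < n | (i < j)%N) \sum_(k < n | (j < k)%N) F i j k).

Lemma eq_sum3 (F G : 'I_n -> 'I_n -> 'I_n -> R) :
  (forall i j k : 'I_n, (i < j)%N -> (j < k)%N -> F i j k = G i j k) -> sum3 F = sum3 G.
Proof.
move=> FG; apply: eq_bigr => i _; apply: eq_bigr => j ij.
by apply: eq_bigr => k jk; exact: FG.
Qed.

Lemma le_sum3 (F G : 'I_n -> 'I_n -> 'I_n -> R) :
  (forall i j k : 'I_n, (i < j)%N -> (j < k)%N -> F i j k <= G i j k) -> sum3 F <= sum3 G.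
Proof.
move=> FG; apply: ler_sum => i _; apply: ler_sum => j ij.
by apply: ler_sum => k jk; exact: FG.
Qed.

Lemma sum3B (F G : 'I_n -> 'I_n -> 'I_n -> R) :
  sum3 F - sum3 G = sum3 (fun i j k => F i j k - G i j k).
Proof.
rewrite -sumrB; apply: eq_bigr => i _; rewrite -sumrB.
by apply: eq_bigr => j _; rewrite -sumrB.
Qed.

Lemma ler_norm_sum3 (F : 'I_n -> 'I_n -> 'I_n -> R) :
  `|sum3 F| <= sum3 (fun i j k => `|F i j k|).
Proof.
apply: (le_trans (ler_norm_sum _ _ _)); apply: ler_sum => i _.
apply: (le_trans (ler_norm_sum _ _ _)); apply: ler_sum => j _.
exact: ler_norm_sum.
Qed.

Lemma eq_TC w w' T : (forall i j : 'I_n, (i < j)%N -> w i j = w' i j) ->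
  TC w T = TC w' T.
Proof.
move=> ww; apply: eq_sum3 => i j k ij jk; rewrite /triplet_cost.
by rewrite !ww// (ltn_trans ij).
Qed.

Lemma eq_BC w w' : (forall i j : 'I_n, (i < j)%N -> w i j = w' i j) ->
  BC w = BC w'.
Proof.
by move=> ww; apply: eq_sum3 => i j k ij jk; rewrite !ww// (ltn_trans ij).
Qed.

Lemma TCB w w' T : TC w T - TC w' T = TC (fun i j => w i j - w' i j) T.
Proof.
rewrite /TC sum3B; apply: eq_sum3 => i j k _ _; rewrite /triplet_cost.
by do !case: ifP => _; ring.
Qed.

Lemma TC_ge w T (q : R) : 0 <= q ->
  (forall i j : 'I_n, (i < j)%N -> q <= w i j) -> 2 * q *+ 'C(n, 3) <= TC w T.
Proof.
move=> q0 wq; rewrite -sum3_const; apply: le_sum3 => i j k ij jk.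
have := wq _ _ ij; have := wq _ _ jk; have := wq _ _ (ltn_trans ij jk).
by rewrite /triplet_cost; do !case: ifP => _; lra.
Qed.

Lemma BC_ge w (q : R) : 
  (forall i j : 'I_n, (i < j)%N -> q <= w i j) -> 2 * q *+ 'C(n, 3) <= BC w.
Proof.
move=> wq; rewrite -sum3_const; apply: le_sum3 => i j k ij jk.
have := wq _ _ ij; have := wq _ _ jk; have := wq _ _ (ltn_trans ij jk).
by rewrite !le_min => *; apply/and3P; split; lra.
Qed.

Definition block_sum u f : R :=
  \sum_(i < n) \sum_(j < n | (i < j)%N) (if f i == f j then u i j else 0).

(* The pairs identified by [isolate k] are those avoiding [k]. *)
Definition isolate (k : 'I_n) : {ffun 'I_n -> 'I_n} :=
  [ffun i => odflt k [pick j | (j != k) && (i != k)]].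

Lemma isolateP k i j : i != j ->
  (isolate k i == isolate k j) = (i != k) && (j != k).
Proof.
have iso a : a != k -> isolate k a != k.
  move=> ak; rewrite ffunE; case: pickP => [b /andP[]//|/(_ a)].
  by rewrite ak.
have isok : isolate k k = k by rewrite ffunE; case: pickP => // b; rewrite eqxx andbF.
have [->|ik] := eqVneq i k; have [->|jk] := eqVneq j k; rewrite ?eqxx//= ?isok => _.
- by rewrite eq_sym; exact/negbTE/iso.
- exact/negbTE/iso.
apply/eqP; rewrite !ffunE; congr odflt; apply: eq_pick => b /=.
by rewrite ik jk.
Qed.

(** In a triple the weight of a pair is paid unless the tree separates that pair from the third
    vertex [k]. For fixed [k] the cost is therefore the weight of all pairs avoiding [k] minus that
    of the separated ones, both of which are block sums. *)
Lemma TC_block_sum u T : is_HC_tree T ->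
  TC u T = \sum_k (block_sum u (isolate k) - block_sum u (sep_class T k)).
Proof.
move=> HT.
have uT : uniq (leaves T) by have /andP[_ /perm_uniq->] := HT; exact: enum_uniq.
pose g i j k := if sep3 T i j k then 0 else u i j.
transitivity (sum3 (fun i j k => g i j k + g i k j + g j k i)).
  (* At most one of the three separations holds, so the nested conditionals of [triplet_cost] agree
     with the symmetric sum of the [g] terms. *)
  apply: eq_sum3 => i j k _ _; rewrite /triplet_cost /g.
  case: ifP => s1.
    rewrite (sep3_exclusive uT s1); rewrite sep3C in s1.
    by rewrite (sep3_exclusive uT s1) add0r.
  case: ifP => s2; last by case: ifP => _; ring.
  rewrite sep3C in s2; have := sep3_exclusive uT s2; rewrite sep3C => s3.
  by rewrite s3 addr0.
rewrite sum3_reindex; apply: eq_bigr => k _; rewrite /block_sum -sumrB.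
apply: eq_bigr => i _; rewrite -sumrB big_mkcondr; apply: eq_bigr => j ij.
have nij : i != j by rewrite -(inj_eq val_inj) neq_ltn ij.
rewrite isolateP// sep_classP// /g.
case: ifP => [_|/negbT]; first by case: ifP; rewrite ?subrr ?subr0.
rewrite negb_and !negbK => /orP[]/eqP->; last by rewrite sep3_right subr0.
by rewrite sep3C sep3_right subr0.
Qed.

Lemma TC_deviation u T (t : R) : is_HC_tree T ->
  (forall f, `|block_sum u f| <= t) -> `|TC u T| <= 2 * n%:R * t.
Proof.
move=> HT ut; rewrite TC_block_sum//.
have -> : 2 * n%:R * t = \sum_(k < n) (2 * t).
  by rewrite sumr_const card_ord -mulr_natl; ring.
apply: (le_trans (ler_norm_sum _ _ _)); apply: ler_sum => k _.
apply: (le_trans (ler_normB _ _)).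
by rewrite mulr_natl mulr2n lerD.
Qed.

Lemma min3_le (a b c a' b' c' A B C : R) : a <= a' + A -> b <= b' + B ->
  c <= c' + C -> 0 <= A -> 0 <= B -> 0 <= C ->
  Num.min (a + b) (Num.min (a + c) (b + c)) <=
  Num.min (a' + b') (Num.min (a' + c') (b' + c')) + (A + B + C).
Proof.
move=> aA bB cC A0 B0 C0; rewrite -lerBlDr.
set m := Num.min (a + b) _.
have m1 : m <= a + b by rewrite ge_min lexx.
have m2 : m <= a + c by rewrite !ge_min lexx orbT.
have m3 : m <= b + c by rewrite !ge_min lexx !orbT.
by clearbody m; rewrite !le_min; apply/and3P; split; lra.
Qed.

(** The minimum over a triple moves by at most the sum of its three weight changes, and a pair is
    counted at most once for each third vertex [k]. *)
Lemma BC_lipschitz w w' : `|BC w - BC w'| <=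
  \sum_(k < n) \sum_(i < n) \sum_(j < n | (i < j)%N) `|w i j - w' i j|.
Proof.
rewrite /BC sum3B; apply: (le_trans (ler_norm_sum3 _)).
apply: (@le_trans _ _ (sum3 (fun i j k => `|w i j - w' i j| + `|w i k - w' i k|
   + `|w j k - w' j k|))).
  apply: le_sum3 => i j k _ _.
  move: (w i j) (w i k) (w j k) (w' i j) (w' i k) (w' j k) => a b c a' b' c'.
  have := normr_ge0 (a - a'); have := normr_ge0 (b - b'); have := normr_ge0 (c - c').
  have := ler_norm (a - a'); have := lerNnormlW (lexx `|a - a'|).
  have := ler_norm (b - b'); have := lerNnormlW (lexx `|b - b'|).
  have := ler_norm (c - c'); have := lerNnormlW (lexx `|c - c'|).
  move: `|a - a'| `|b - b'| `|c - c'| => A B C *.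
  by rewrite ler_norml; apply/andP; split;
    [rewrite lerNl opprB lerBlDl|rewrite lerBlDl]; apply: min3_le; lra.
rewrite (sum3_reindex (fun i j k => `|w i j - w' i j|)).
apply: ler_sum => k _; apply: ler_sum => i _; rewrite big_mkcondr.
by apply: ler_sum => j _; case: ifP.
Qed.

End Deviation.

(** * The random graph as a product Bernoulli measure *)

Section EdgeIndicators.
Variables (n : nat) (R : realType) (P : 'M[R]_n).
Hypothesis P01 : forall i j : 'I_n, 0 <= P i j <= 1.
Implicit Types (E : {set 'I_n * 'I_n}) (i j k : 'I_n).

(** Pairs that are not increasing get probability 0, so that [graph_prob] becomes a product measure
    over all of ['I_n * 'I_n]. *)
Definition edge_prob (x : 'I_n * 'I_n) : R :=
  if (x.1 < x.2)%N then P x.1 x.2 else 0.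

(** One-sided version of [graph_w]: flipping a coordinate changes exactly one entry. The two agree
    almost surely on increasing pairs, the only ones that the costs read. *)
Definition edge_w E i j : R := ((i, j) \in E)%:R.

Lemma edge_prob01 x : 0 <= edge_prob x <= 1.
Proof. by rewrite /edge_prob; case: ifP => _; rewrite ?lexx ?ler01. Qed.

Lemma graph_probE E : graph_prob P E = bern edge_prob E.
Proof.
rewrite /graph_prob /bern; case: ifP => [/fintype.subsetP EU|/negbT/fintype.subsetPn[x xE xU]].
  rewrite [RHS](bigID (mem upper_pairs)) /= [X in _ * X]big1 ?mulr1.
    by apply: eq_bigr => x; rewrite inE /edge_prob => ->.
  move=> x xU; have xE : x \notin E by apply: contraNN xU => /EU.
  by move: xU; rewrite inE (negPf xE) /edge_prob => /negPf->; rewrite subr0.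
rewrite (bigD1 x)//= xE /edge_prob; move: xU; rewrite inE => /negPf->.
by rewrite mul0r.
Qed.

Lemma ExpectE F : Expect P F = Ex edge_prob F.
Proof. by apply: eq_bigr => E _; rewrite graph_probE. Qed.

Lemma ProbE (ev : {set 'I_n * 'I_n} -> Prop) :
  Prob P ev = Ex edge_prob (fun E => `[< ev E >]%:R).
Proof.
apply: eq_bigr => E _; rewrite graph_probE.
by case: ifP => _; rewrite ?mulr1 ?mulr0.
Qed.

Lemma graph_w_edge_w E : bern edge_prob E != 0 ->
  forall i j, (i < j)%N -> graph_w E i j = edge_w E i j.
Proof.
rewrite -graph_probE /graph_prob; case: ifP => [/fintype.subsetP EU _ i j ij|]; last by rewrite eqxx.
rewrite /graph_w /edge_w; have /negPf-> : (j, i) \notin E.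
  by apply/negP => /EU; rewrite inE /= ltnNge ltnW.
by rewrite orbF; case: (_ \in E).
Qed.

Lemma Ex_edge_w i j : (i < j)%N -> Ex edge_prob (fun E => edge_w E i j) = P i j.
Proof.
move=> ij; rewrite -(Ex_avg _ (i, j)) -[RHS](Ex_cst edge_prob); apply: eq_Ex => E _.
by rewrite /avg /edge_w /edge_prob /= ij !inE eqxx /= mulr0 addr0 mulr1.
Qed.

Lemma Ex_edge_w2 i j k : (i < j)%N -> (i < k)%N -> j != k ->
  Ex edge_prob (fun E => edge_w E i j * edge_w E i k) = P i j * P i k.
Proof.
move=> ij ik jk; rewrite -(Ex_avg _ (i, j)) -(Ex_edge_w ik) -ExZ.
apply: eq_Ex => E _.
rewrite /avg /edge_w /edge_prob /= ij !inE !xpair_eqE !eqxx /= [k == j]eq_sym.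
by rewrite (negPf jk) /= mul0r mulr0 addr0 mul1r.
Qed.

Lemma edge_w_diff x E i j :
  `|edge_w (x |: E) i j - edge_w (E :\ x) i j| = ((i, j) == x)%:R.
Proof.
rewrite /edge_w !inE; case: eqP => _ /=; first by rewrite subr0 normr1.
by rewrite subrr normr0.
Qed.

Lemma sum_edge_delta_le (x : 'I_n * 'I_n) :
  \sum_(i < n) \sum_(j < n | (i < j)%N) ((i, j) == x)%:R <= 1 :> R.
Proof.
apply: (@le_trans _ _ (\sum_(i < n) \sum_(j < n) ((i, j) == x)%:R)).
  by apply: ler_sum => i _; rewrite big_mkcond; apply: ler_sum => j _; case: ifP.
rewrite (pair_bigA _ (fun i j => ((i, j) == x)%:R)) (bigD1 x)//= -surjective_pairing eqxx.
by rewrite big1 ?addr0// => y /negPf yx; rewrite -surjective_pairing yx.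
Qed.

Lemma bdiff_block_sum f : bdiff 1 (fun E => block_sum (edge_w E) f).
Proof.
move=> x E; rewrite /block_sum -sumrB.
apply: le_trans (sum_edge_delta_le x).
apply: (le_trans (ler_norm_sum _ _ _)); apply: ler_sum => i _.
rewrite -sumrB; apply: (le_trans (ler_norm_sum _ _ _)); apply: ler_sum => j _.
by case: ifP => _; rewrite ?edge_w_diff// subrr normr0.
Qed.

Lemma bdiff_BC : bdiff n%:R (fun E => BC (edge_w E)).
Proof.
move=> x E; apply: (le_trans (BC_lipschitz _ _)).
have -> : n%:R = \sum_(k < n) 1 :> R by rewrite sumr_const card_ord.
apply: ler_sum => k _; apply: le_trans (sum_edge_delta_le x).
by apply: ler_sum => i _; apply: ler_sum => j _; rewrite edge_w_diff.
Qed.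

Lemma Ex_block_sum f :
  Ex edge_prob (fun E => block_sum (edge_w E) f) = block_sum (expect_w P) f.
Proof.
rewrite /block_sum Ex_sum; apply: eq_bigr => i _; rewrite Ex_sum.
by apply: eq_bigr => j ij; case: ifP => _; rewrite ?Ex_cst ?Ex_edge_w.
Qed.

(** If the edges [ij] and [ik] are both present, each of the three sums in the minimum is at least
    1. The minimum thus dominates the product of two independent indicators. *)
Lemma Ex_BC_ge (q : R) : 0 <= q -> (forall i j, (i < j)%N -> q <= P i j) ->
  q ^+ 2 *+ 'C(n, 3) <= Ex edge_prob (fun E => BC (edge_w E)).
Proof.
move=> q0 Pq; rewrite -sum3_const /BC Ex_sum; apply: ler_sum => i _.
rewrite Ex_sum; apply: ler_sum => j ij; rewrite Ex_sum; apply: ler_sum => k jk.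
have ik := ltn_trans ij jk.
have njk : j != k by rewrite -(inj_eq val_inj) neq_ltn jk.
apply: (@le_trans _ _ (P i j * P i k)).
  by rewrite expr2 ler_pM ?Pq.
rewrite -Ex_edge_w2//; apply: Ex_le => [|E _]; first exact: edge_prob01.
rewrite /edge_w !le_min.
by do 3!case: (_ \in E) => /=; apply/and3P; split; lra.
Qed.

End EdgeIndicators.

(** * Concentration of the ratio *)

(** The bound 4 is sharp for the constant 24: at [n = 3] it would read 27 against 24. *)
Lemma binom3_ge (R : realType) n : (4 <= n)%N ->
  n%:R ^+ 3 <= 24 * 'C(n, 3)%:R :> R.
Proof.
move=> n4; rewrite -natrX -natrM ler_nat.
have := bin_ffact n 3; rewrite !ffactnS ffactn0 !factS fact0.
move: 'C(n, 3) => b; case: n n4 => [|[|[|[|m]]]]//= _; nia.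
Qed.

Lemma rho_TC_le (R : realType) n (w : 'I_n -> 'I_n -> R) T T' :
  0 < BC w -> optimal_tree w T -> is_HC_tree T' -> TC w T <= TC w T'.
Proof.
move=> B0 [_ opt] /opt; rewrite /rho gt_eqF//.
by rewrite lee_fin ler_pM2r ?invr_gt0.
Qed.

Lemma pos_perturb (R : realType) (e b y : R) :
  0 < e <= 1 -> 0 < b -> `|y - b| <= e / 8 * b -> 0 < y.
Proof.
move=> /andP[e0 e1] b0; rewrite ler_norml => /andP[y1 _].
by nra.
Qed.

(** Relative errors [e / 8] suffice because [(1 - e) * (1 + e / 8) <= 1 - e / 8] and
    [1 + e / 8 <= (1 + e) * (1 - e / 8)] for [e] in the unit interval. *)
Lemma ratio_perturb (R : realType) (e a b x y : R) :
  0 < e <= 1 -> 0 <= a -> 0 < b -> `|x - a| <= e / 8 * a -> `|y - b| <= e / 8 * b ->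
  (1 - e) * (a / b) <= x / y <= (1 + e) * (a / b).
Proof.
move=> e01 a0 b0 hx hy; have y0 := pos_perturb e01 b0 hy.
move: e01 hx hy => /andP[e0 e1]; rewrite !ler_norml => /andP[x1 x2] /andP[y1 y2].
rewrite !mulrA ler_pdivrMr// ler_pdivlMr//.
rewrite [x / y * b]mulrAC ler_pdivlMr// ler_pdivrMr//.
have ea : 0 <= e * a by apply: mulr_ge0 => //; lra.
have eea : 0 <= e * (e * a) by apply: mulr_ge0 => //; lra.
have eea2 : e * (e * a) <= e * a by rewrite ler_piMl.
apply/andP; split.
  apply: (@le_trans _ _ ((1 - e / 8) * a * b)); last by rewrite ler_wpM2r; lra.
  apply: (@le_trans _ _ ((1 - e) * a * ((1 + e / 8) * b))).
    by rewrite ler_wpM2l ?mulr_ge0; lra.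
  by rewrite mulrA ler_wpM2r; lra.
apply: (@le_trans _ _ ((1 + e / 8) * a * b)); first by rewrite ler_wpM2r; lra.
apply: (@le_trans _ _ ((1 + e) * a * ((1 - e / 8) * b))).
  by rewrite [leRHS]mulrA ler_wpM2r; lra.
by rewrite ler_wpM2l ?mulr_ge0; lra.
Qed.

(** Exponent of [mcdiarmid] for a block sum, with [c = 1] and [S = N ^+ 2]. The value 5 is chosen so
    that its square divided by 8 exceeds 3, which leaves room for a union bound over [expR (N * L)]
    maps. *)
Lemma TC_exponent (R : realType) (e q N K L : R) : 0 < N -> 0 <= L ->
  e / 8 * K / 24 = 5 -> N * q ^+ 2 = K ^+ 2 * L ->
  3 * N * L <= (e / 8 * q * N ^+ 2 / 24) ^+ 2 / (8 * N ^+ 2).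
Proof.
move=> N0 L0 eK Nq.
have -> : (e / 8 * q * N ^+ 2 / 24) ^+ 2 / (8 * N ^+ 2) =
    (e / 8 / 24) ^+ 2 * N * (N * q ^+ 2) / 8 by field; rewrite gt_eqF.
rewrite Nq; have -> : (e / 8 / 24) ^+ 2 * N * (K ^+ 2 * L) / 8 =
    (e / 8 * K / 24) ^+ 2 * (N * L) / 8 by field.
have : 0 <= N * L by rewrite mulr_ge0// ltW.
by rewrite eK -[3 * N * L]mulrA; move: (N * L) => x x0; lra.
Qed.

(** Here [c = N] on [N ^+ 2] coordinates, hence [S = N ^+ 4]. The exponent is of order
    [K ^+ 2 * L ^+ 2], which [1 <= K] and [1 <= L] reduce to a multiple of [L]. *)
Lemma BC_exponent (R : realType) (e q N K L : R) : 0 < N -> 1 <= L -> 1 <= K ->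
  e / 8 * K / 24 = 5 -> N * q ^+ 2 = K ^+ 2 * L ->
  3 * L <= (e / 8 * q ^+ 2 * N ^+ 3 / 24) ^+ 2 / (8 * N ^+ 4).
Proof.
move=> N0 L1 K1 eK Nq.
have -> : (e / 8 * q ^+ 2 * N ^+ 3 / 24) ^+ 2 / (8 * N ^+ 4) =
    (e / 8 / 24) ^+ 2 * (N * q ^+ 2) ^+ 2 / 8 by field; rewrite gt_eqF.
rewrite Nq; have -> : (e / 8 / 24) ^+ 2 * (K ^+ 2 * L) ^+ 2 / 8 =
    (e / 8 * K / 24) ^+ 2 * (K ^+ 2 * (L * L)) / 8 by field.
have LL : L <= L * L by rewrite ler_peMl// (le_trans ler01).
have : L * L <= K ^+ 2 * (L * L).
  by rewrite ler_peMl ?exprn_ege1// mulr_ge0// (le_trans ler01).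
by rewrite eK; move: (L * L) LL => y; move: (K ^+ 2 * y) => x *; lra.
Qed.

(* [TC_step] and [BC_step] keep the exponential parameter of Chernoff's bound
   in the range where [mcdiarmid] applies. *)
Lemma TC_step (R : realType) (e q N : R) : e * q <= 1 ->
  e / 8 * q * N ^+ 2 / 24 <= 2 * N ^+ 2.
Proof.
move=> eq1; have -> : e / 8 * q * N ^+ 2 / 24 = e * q / 8 / 24 * N ^+ 2 by ring.
by apply: ler_wpM2r; [exact: sqr_ge0|lra].
Qed.

Lemma BC_step (R : realType) (e q N : R) : 0 <= N -> e * q ^+ 2 <= 1 ->
  e / 8 * q ^+ 2 * N ^+ 3 / 24 * N <= 2 * N ^+ 4.
Proof.
move=> N0 eq1.
have -> : e / 8 * q ^+ 2 * N ^+ 3 / 24 * N = e * q ^+ 2 / 8 / 24 * N ^+ 4 by ring.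
by apply: ler_wpM2r; [exact: exprn_ge0|lra].
Qed.

Section SingleGraph.
Variables (n : nat) (R : realType) (P : 'M[R]_n).
Hypothesis P01 : forall i j : 'I_n, 0 <= P i j <= 1.
Hypothesis n4 : (4 < n)%N.

Local Notation EBC := (Ex (edge_prob P) (fun E => BC (edge_w R E))).

Definition expect_ratio (T : hctree n) : R :=
  TC (expect_w P) T / Expect P (fun E => BC (graph_w E)).

Definition near_ratio (e : R) (Tbar : hctree n) (E : {set 'I_n * 'I_n}) :=
  forall T : hctree n, optimal_tree (graph_w (R:=R) E) T ->
    (((1 - e) * expect_ratio Tbar)%:E <= rho (graph_w (R:=R) E) T
     <= ((1 + e) * expect_ratio Tbar)%:E)%E.

Lemma Expect_BC : Expect P (fun E => BC (graph_w E)) = EBC.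
Proof. by rewrite ExpectE; apply: eq_Ex => E /graph_w_edge_w; exact: eq_BC. Qed.

Lemma expect_ratio_ge0 T : 0 <= expect_ratio T.
Proof.
rewrite /expect_ratio Expect_BC divr_ge0//.
  by rewrite -(mul0rn _ 'C(n, 3)) -(mulr0 2) TC_ge// => i j _; case/andP: (P01 i j).
rewrite -(mul0rn _ 'C(n, 3)) -[X in X *+ _](expr0n R 2) Ex_BC_ge// => i j _.
by case/andP: (P01 i j).
Qed.

(** Nonnegativity of the ratio makes the interval grow with the tolerance; this monotonicity drives
    the diagonal argument. *)
Lemma Prob_near_ratio_homo (e e' : R) T : e <= e' ->
  Prob P (near_ratio e T) <= Prob P (near_ratio e' T).
Proof.
move=> ee; rewrite !ProbE; apply: Ex_le => [x|E _]; first exact: edge_prob01.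
rewrite ler_nat; case: asboolP => // ev; rewrite asboolT// => T' /ev/andP[h1 h2].
have r0 := expect_ratio_ge0 T.
apply/andP; split.
  by apply: le_trans h1; rewrite lee_fin ler_wpM2r// lerD2l lerN2.
by apply: (le_trans h2); rewrite lee_fin ler_wpM2r// lerD2l.
Qed.

Variables (q e : R).
Hypotheses (q0 : 0 < q) (Pq : forall i j : 'I_n, (i < j)%N -> q <= P i j).
Hypothesis e01 : 0 < e <= 1.

Let N : R := n%:R.
(** Both tolerances come from [N ^+ 3 / 24 <= 'C(n, 3)]: [2 * N * t1] and [t2] are [e / 8] times the
    resulting lower bounds on the cost of any tree and on the expected [BC]. *)
Let t1 : R := e / 8 * q * N ^+ 2 / 24.
Let t2 : R := e / 8 * q ^+ 2 * N ^+ 3 / 24.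

Lemma near_ratio_of_deviation Tbar E :
  optimal_tree (expect_w P) Tbar -> bern (edge_prob P) E != 0 ->
  (forall f, `|block_sum (edge_w R E) f - block_sum (expect_w P) f| <= t1) ->
  `|BC (edge_w R E) - EBC| <= t2 -> near_ratio e Tbar E.
Proof.
move=> optbar /graph_w_edge_w wE hf hB T optT; have [HTbar _] := optbar.
have [HT _] := optT.
have e0 : 0 < e by case/andP: e01.
set M : R := 'C(n, 3)%:R.
have NM : N ^+ 3 <= 24 * M by rewrite binom3_ge// ltnW.
have M0 : 0 < M by rewrite ltr0n bin_gt0; lia.
have TCM T' : 2 * q * M <= TC (expect_w P) T'.
  by rewrite /M mulr_natr TC_ge// ltW.
have BP0 : 0 < BC (expect_w P).
  apply: lt_le_trans (BC_ge Pq); rewrite -mulr_natr -/M !mulr_gt0//.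
have EBCM : q ^+ 2 * M <= EBC by rewrite /M mulr_natr Ex_BC_ge// ltW.
have qM : 0 < q ^+ 2 * M by rewrite mulr_gt0// exprn_gt0.
have EBC0 : 0 < EBC by exact: lt_le_trans EBCM.
(* The error is uniform in [T'] yet relative to the cost of [Tbar], because the lower bound [TCM]
   holds for every tree. *)
have dev T' : is_HC_tree T' ->
    `|TC (graph_w E) T' - TC (expect_w P) T'| <= e / 8 * TC (expect_w P) Tbar.
  move=> HT'; rewrite (eq_TC T' wE) TCB.
  apply: (@le_trans _ _ (2 * N * t1)).
    apply: TC_deviation => // f; apply: le_trans (hf f); rewrite le_eqVlt; apply/orP; left.
    apply/eqP; congr `|_|; rewrite /block_sum -sumrB; apply: eq_bigr => i _.
    by rewrite -sumrB; apply: eq_bigr => j _; case: ifP => //; rewrite subrr.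
  have -> : 2 * N * t1 = e / 8 * (2 * q * (N ^+ 3 / 24)).
    by rewrite /t1; field.
  apply: ler_wpM2l; first by lra.
  apply: le_trans (TCM Tbar).
  apply: ler_wpM2l; first by rewrite mulr_ge0// ltW.
  by rewrite ler_pdivrMr// mulrC.
have hB' : `|BC (graph_w E) - EBC| <= e / 8 * EBC.
  rewrite (eq_BC wE); apply: (le_trans hB).
  have -> : t2 = e / 8 * (q ^+ 2 * (N ^+ 3 / 24)) by rewrite /t2; field.
  apply: ler_wpM2l; first by lra.
  apply: le_trans EBCM.
  by rewrite ler_wpM2l ?sqr_ge0// ler_pdivrMr// mulrC.
have a0 : 0 <= TC (expect_w P) Tbar.
  by apply: le_trans (TCM Tbar); rewrite !mulr_ge0// ltW.
have y0 := pos_perturb e01 EBC0 hB'.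
(* [T] is at least as cheap as [Tbar] on the graph, and [Tbar] at least as cheap as [T] on the
   expectation graph, so the two optimal costs differ by no more than the uniform deviation. *)
have hT : `|TC (graph_w E) T - TC (expect_w P) Tbar| <= e / 8 * TC (expect_w P) Tbar.
  have := dev _ HT; have := dev _ HTbar; rewrite !ler_norml => /andP[_ d1] /andP[d2 _].
  have o1 := rho_TC_le y0 optT HTbar.
  have o2 := rho_TC_le BP0 optbar HT.
  by apply/andP; split; lra.
have h := ratio_perturb e01 a0 EBC0 hT hB'.
by rewrite /expect_ratio Expect_BC /rho gt_eqF// !lee_fin.
Qed.

Lemma Prob_near_ratio Tbar (K : R) : q <= 1 -> 1 <= ln N -> 1 <= K ->
  optimal_tree (expect_w P) Tbar ->
  e / 8 * K / 24 = 5 -> N * q ^+ 2 = K ^+ 2 * ln N ->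
  1 - N^-1 < Prob P (near_ratio e Tbar).
Proof.
move=> q1 L1 K1 optbar eK Nq.
have e0 : 0 < e by case/andP: e01.
have e1 : e <= 1 by case/andP: e01.
have N4 : 5 <= N by rewrite (ler_nat R 5).
have N0 : 0 < N by lra.
have p01 := edge_prob01 P01.
set L := ln N in L1 Nq *.
have NL : N = expR L by rewrite lnK.
have L0 : 0 <= L := le_trans ler01 L1.
have eq1 : e * q <= 1 by rewrite mulr_ile1// ltW.
have eqq1 : e * q ^+ 2 <= 1 by rewrite mulr_ile1 ?sqr_ge0 ?exprn_ile1// ltW.
have t10 : 0 <= t1 by rewrite !mulr_ge0 ?sqr_ge0 ?ltW.
have t20 : 0 <= t2 by rewrite !mulr_ge0 ?sqr_ge0 ?exprn_ge0 ?ltW.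
have cardI : #|{: 'I_n * 'I_n}|%:R = N ^+ 2 :> R.
  by rewrite card_prod card_ord natrM expr2.
have dev1 (f : {ffun 'I_n -> 'I_n}) :
  Ex (edge_prob P) (fun E => (t1 < `|block_sum (edge_w R E) f - block_sum (expect_w P) f|)%R%:R)
  <= 2 * expR (- (3 * N * L)).
  rewrite -(Ex_block_sum P).
  have S0 : 0 < N ^+ 2 by rewrite exprn_gt0.
  have H := @mcdiarmid R _ (edge_prob P) 1 t1 _ _ p01 ler01 (@bdiff_block_sum n R f) S0.
  apply: (le_trans (H _ t10 _)).
  - by rewrite cardI expr1n mul1r.
  - by rewrite mulr1 TC_step.
  by rewrite ler_wpM2l// ler_expR lerN2 (TC_exponent _ _ eK).
have dev2 : Ex (edge_prob P) (fun E => (t2 < `|BC (edge_w R E) - EBC|)%R%:R)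
  <= 2 * expR (- (3 * L)).
  have S0 : 0 < N ^+ 4 by rewrite exprn_gt0.
  have H := @mcdiarmid R _ (edge_prob P) N t2 _ _ p01 (ltW N0) (@bdiff_BC n R) S0.
  apply: (le_trans (H _ t20 _)).
  - by rewrite cardI -/N -exprD.
  - by apply: BC_step => //; exact: ltW.
  by rewrite ler_wpM2l// ler_expR lerN2 (BC_exponent _ _ _ eK).
pose bad := \sum_f Ex (edge_prob P)
   (fun E => (t1 < `|block_sum (edge_w R E) f - block_sum (expect_w P) f|)%R%:R)
   + Ex (edge_prob P) (fun E => (t2 < `|BC (edge_w R E) - EBC|)%R%:R).
have badle : bad < N^-1.
  (* Block sums and [BC] contribute at most [2 * expR (- (2 * L))] each. The total is [4 / N ^+ 2],
     below [N^-1] since [N] is at least 5. *)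
  apply: (@le_lt_trans _ _ (4 * expR (- (2 * L)))).
    have -> : 4 * expR (- (2 * L)) = 2 * expR (- (2 * L)) + 2 * expR (- (2 * L)) by ring.
    apply: lerD; last by apply: (le_trans dev2); rewrite ler_wpM2l// ler_expR; lra.
    apply: (@le_trans _ _ (\sum_(f : {ffun 'I_n -> 'I_n}) 2 * expR (- (3 * N * L)))).
      by apply: ler_sum => f _; exact: dev1.
    rewrite sumr_const card_ffun card_ord -[leLHS]mulr_natr natrX -/N.
    have -> : N ^+ n = expR (N * L) by rewrite {1}NL -expRM_natl.
    rewrite -mulrA -expRD ler_wpM2l// ler_expR.
    have : L <= N * L by rewrite ler_peMl; lra.
    by lra.
  have -> : - (2 * L) = - L + - L by ring.
  rewrite expRD expRN -NL mulrA gtr_pMl ?invr_gt0//.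
  by rewrite ltr_pdivrMr// mul1r; lra.
apply: (@lt_le_trans _ _ (1 - bad)); first by rewrite ltrD2l ltrN2.
(* Union bound in pointwise form: the indicator of the good event is at least 1 minus the number of
   deviations that occur. *)
have -> : 1 - bad = Ex (edge_prob P) (fun E => 1 + - 1 * (
   \sum_f (t1 < `|block_sum (edge_w R E) f - block_sum (expect_w P) f|)%R%:R
   + (t2 < `|BC (edge_w R E) - EBC|)%R%:R)).
  by rewrite ExD ExZ ExD Ex_sum Ex_cst mulN1r.
rewrite ProbE; apply: Ex_le => // E bE; rewrite mulN1r lerBlDr.
have s0 : 0 <= \sum_(f : {ffun 'I_n -> 'I_n})
   (t1 < `|block_sum (edge_w R E) f - block_sum (expect_w P) f|)%R%:R :> R.
  by apply: sumr_ge0 => f _.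
have [_|hB] := ltP t2; first by rewrite addrA lerDr addr_ge0.
rewrite addr0.
have [/existsP[f hf]|] := boolP [exists f : {ffun 'I_n -> 'I_n},
   (t1 < `|block_sum (edge_w R E) f - block_sum (expect_w P) f|)%R].
  rewrite (bigD1 f)//= hf addrCA lerDl addr_ge0// sumr_ge0//.
rewrite negb_exists => /forallP hf.
rewrite (_ : `[< _ >] = true) ?lerDl//.
apply/asboolP; apply: near_ratio_of_deviation => // f.
by have := hf f; rewrite -leNgt.
Qed.

End SingleGraph.

(** * From fixed tolerances to a vanishing error sequence *)

Lemma diagonal_eps (R : realType) (Q : R -> nat -> Prop) :
  (forall e e' n, e <= e' -> Q e n -> Q e' n) ->
  (forall e, 0 < e <= 1 -> exists N, forall n, (N <= n)%N -> Q e n) ->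
  exists delta : nat -> R,
    (forall e : R, 0 < e -> exists N, forall n, (N <= n)%N -> `|delta n| <= e) /\
    exists N, forall n, (N <= n)%N -> Q (delta n) n.
Proof.
move=> Qhomo Qev; pose S n : set R := [set e | 0 < e /\ Q e n]%classic.
have lbS n : has_lbound (S n) by exists 0 => x [/ltW].
(* The infimum of the admissible tolerances need not be admissible; the slack [n.+1%:R^-1] passes
   above some admissible one and still tends to 0. *)
exists (fun n => inf (S n) + n.+1%:R^-1); split.
  move=> e e0; pose e' := Num.min (e / 2) 1.
  have e'01 : 0 < e' <= 1 by rewrite ge_min lexx orbT lt_min ltr01 divr_gt0.
  have [N1 HN1] := Qev _ e'01.
  exists (maxn N1 (Num.truncn (2 / e))) => n; rewrite geq_max => /andP[n1 n2].
  have Se' : S n e' by split; [case/andP: e'01|exact: HN1].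
  have i0 : 0 <= inf (S n) by apply: lb_le_inf; [exists e'|move=> x [/ltW]].
  have i1 : inf (S n) <= e / 2.
    by apply: (@le_trans _ _ e'); [exact: ge_inf|rewrite ge_min lexx].
  have i2 : n.+1%:R^-1 <= e / 2.
    rewrite -[leRHS]invrK lef_pV2 ?posrE ?invr_gt0 ?divr_gt0 ?ltr0n// invf_div.
    apply/ltW/(lt_le_trans (truncnS_gt _)); by rewrite ler_nat.
  by rewrite ger0_norm ?addr_ge0// (splitr e) lerD.
have [|N1 HN1] := Qev 1; first by rewrite ltr01 lexx.
exists N1 => n n1.
have hS : has_inf (S n) by split=> //; exists 1; split=> //; exact: HN1.
have [|x [x0 Qx] xlt] := @inf_adherent _ (S n) n.+1%:R^-1 _ hS.
  by rewrite invr_gt0 ltr0n.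
exact: Qhomo (ltW xlt) Qx.
Qed.

Theorem theorem8 (R : realType) (P : forall n : nat, 'M[R]_n)
  (Psym : forall n : nat, (P n)^T = P n)
  (P01 : forall (n : nat) (i j : 'I_n), 0 <= P n i j <= 1)
  (Pomega : forall C : R, 0 < C -> exists N : nat, forall n : nat, (N <= n)%N ->
     forall i j : 'I_n, i != j -> C * Num.sqrt (ln (n%:R) / n%:R) <= P n i j) :
  exists eps : R, 0 < eps /\
  exists delta : nat -> R,
    (forall e : R, 0 < e -> exists N : nat, forall n : nat, (N <= n)%N -> `|delta n| <= e) /\
    exists N : nat, forall n : nat, (N <= n)%N ->
      forall Tbar : hctree n, optimal_tree (expect_w (P n)) Tbar ->
      let ratio := TC (expect_w (P n)) Tbar / Expect (P n) (fun E => BC (graph_w E)) in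
      1 - n%:R `^ (- eps) <
      Prob (P n) (fun E => forall T : hctree n, optimal_tree (graph_w (R:=R) E) T ->
                     (((1 - delta n) * ratio)%:E <= rho (graph_w (R:=R) E) T <=
                      ((1 + delta n) * ratio)%:E)%E).
Proof.
exists 1; split=> //.
apply: (@diagonal_eps R (fun e n => forall Tbar : hctree n,
  optimal_tree (expect_w (P n)) Tbar ->
  1 - n%:R `^ (- 1) < Prob (P n) (near_ratio (P n) e Tbar))).
  move=> e e' n ee Qe Tbar /Qe h.
  exact: lt_le_trans (Prob_near_ratio_homo (P01 n) Tbar ee).
move=> e e01; have e0 : 0 < e by case/andP: e01.
have [K [K1 eK]] : exists K : R, 1 <= K /\ e / 8 * K / 24 = 5.
  (* Solves the equation required by the exponent lemmas; [Pomega] is then used with this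
     constant. *)
  exists (5 * 24 * (8 / e)); split; last by field; rewrite gt_eqF.
  have : 1 <= 8 / e by case/andP: e01 => _ e1; rewrite ler_pdivlMr// mul1r; lra.
  by move: (8 / e) => x; lra.
have K0 : 0 < K := lt_le_trans ltr01 K1.
have [N0 HN0] := Pomega K K0.
exists (maxn 5 N0) => n; rewrite geq_max => /andP[n5 n0] Tbar optbar.
have N5 : 5 <= n%:R :> R by rewrite (ler_nat R 5).
rewrite powR_inv1; last by lra.
have L1 : 1 <= ln n%:R :> R.
  rewrite -ler_expR lnK ?posrE; last by lra.
  (* The quadratic bound equals 2 at one half, so [expR 1] is at most 4, which is below [n]. *)
  have h : expR 2^-1 <= 1 + 2^-1 + 2 * (2^-1) ^+ 2 :> R by exact: expR_le_quad.
  have -> : 1 = 2^-1 + 2^-1 :> R by lra.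
  have := expR_gt0 (2^-1 : R); rewrite expRD; nra.
have s0 : 0 < Num.sqrt (ln n%:R / n%:R : R) by rewrite sqrtr_gt0 divr_gt0; lra.
apply: (@Prob_near_ratio _ _ _ _ _ (K * Num.sqrt (ln n%:R / n%:R))
  _ _ _ _ _ K) => //.
- by rewrite mulr_gt0.
- by move=> i j ij; apply: HN0 => //; rewrite -(inj_eq val_inj) neq_ltn ij.
(* [q <= 1] is read off from one actual off-diagonal entry, which is a probability bounded below by
   [q]. *)
- case: n n5 n0 {Tbar optbar N5 L1 s0} => [|[|n]]// n5 n0.
  have /andP[_ p1] := P01 _ (ord0 : 'I_n.+2) ord_max.
  by apply: le_trans p1; exact: HN0.
- rewrite exprMn sqr_sqrtr; last by rewrite divr_ge0; lra.
  by field; lra.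
Qed.
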